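(* There is a sample size $m=m(\varepsilon,\alpha,\beta)=\mathcal{O}\!\left(\frac1{\varepsilon^2\alpha^2}\log\frac1\beta\right)$ such that, if the sample maintained by Dwork's Density Estimator consists of $m$ users from $\mathcal{U}$, then for every fixed input stream $\mathcal{S}$, $$\mathbb{P}\bigl(|\tilde d-d(\mathcal{S})|\ge\alpha\bigr)\le\beta,$$ where the probability space is over the random choices of the algorithm.
   Context: Streams: $\mathcal{U}$ is a finite universe of users (with $|\mathcal{U}|\ge m$); a data stream is a finite sequence $\mathcal{S}=(s_1,\dots,s_T)$ with $s_t\in\mathcal{U}$. The density $d(\mathcal{S})$ is the number of distinct users appearing in $\mathcal{S}$ divided by $|\mathcal{U}|$. Parameters: $0<\varepsilon\le\frac12$ and accuracy parameters $\alpha,\beta\in(0,1)$; the $\mathcal{O}$ is for $\varepsilon,\alpha,\beta\to0$, and its constant does not depend on $\mathcal{U}$ or $\mathcal{S}$. Dwork's Density Estimator (sample size $m$): sample a uniformly random subset $M\subseteq\mathcal{U}$ of $m$ users without replacement, ordered as $M[1],\dots,M[m]$; keep a bit array $\mathbf{b}=[b_1\ \dots\ b_m]$, with entries initialized independently as $b_i\sim\mathrm{Bernoulli}(\frac12)$. For $t=1,\dots,T$: if $s_t=M[i]$ for some $i$, re-sample $b_i\sim\mathrm{Bernoulli}(\frac12+\frac\varepsilon4)$ (with fresh randomness). At the end output $$\tilde d=\frac4\varepsilon\Bigl(\frac1m\sum_{i=1}^m b_i-\frac12\Bigr)+\mathrm{Laplace}\bigl(0,\tfrac1{\varepsilon m}\bigr),$$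 where $\mathrm{Laplace}(0,s)$ denotes an independent random variable with density $\frac1{2s}e^{-|x|/s}$. *)

(* Defs.v *)
From HB Require Import structures.
From mathcomp Require Import all_boot all_order all_algebra.
From mathcomp Require Import all_classical all_reals all_analysis.
From mathcomp Require Import measurable_realfun.
From mathcomp Require Import lra.

Set Implicit Arguments.
Unset Strict Implicit.
Unset Printing Implicit Defensive.

Import Order.TTheory GRing.Theory Num.Theory.
Import numFieldNormedType.Exports.

Local Open Scope classical_set_scope.
Local Open Scope ring_scope.

Section laplace.
Context {R : realType}.
Implicit Types s x : R.
Local Notation mu := (@lebesgue_measure R).

Definition laplace_pdf s x : R := (2 * s)^-1 * expR (- `|x| / s).

Lemma laplace_pdf_ge0 s x : 0 < s -> 0 <= laplace_pdf s x.
Proof. by move=> s0; rewrite mulr_ge0 ?expR_ge0// invr_ge0 mulr_ge0// ltW. Qed.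

Lemma continuous_laplace_pdf s : continuous (laplace_pdf s).
Proof.
move=> x; apply: (@continuousM _ R^o (fun=> (2 * s)^-1)
  (fun x => expR (- `|x| / s))); first exact: cst_continuous.
apply: continuous_comp; last exact: continuous_expR.
apply: (@continuousM _ R^o (fun x => - `|x|) (fun=> s^-1));
  last exact: cst_continuous.
apply: (@continuousN _ R^o); exact: (@norm_continuous _ R^o).
Qed.

Lemma measurable_laplace_pdf s : measurable_fun [set: R] (laplace_pdf s).
Proof. apply: continuous_measurable_fun; exact: continuous_laplace_pdf. Qed.

Lemma integral_laplace_pdf s : 0 < s ->
  (\int[mu]_x (laplace_pdf s x)%:E = 1)%E.
Proof.
move=> s0; rewrite ge0_symfun_integralT//=.
- have mE : measurable_fun [set: R] (EFin \o exponential_pdf s^-1).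
    by apply/measurable_EFinP; exact: measurable_exponential_pdf.
  transitivity (2%:E * (2^-1%:E * \int[mu]_x (exponential_pdf s^-1 x)%:E))%E.
    congr (_ * _)%E.
    rewrite -ge0_integralZl//=; last first.
      by move=> x _; rewrite lee_fin exponential_pdf_ge0// invr_ge0 ltW.
    rewrite [LHS]integral_mkcond/=; apply: eq_integral => x _.
    rewrite patchE; case: ifPn.
      rewrite inE/= => x0; rewrite exponential_pdfE// /laplace_pdf.
      by rewrite ger0_norm// invfM -EFinM mulrA mulNr [x * _]mulrC mulNr.
    rewrite notin_setE/= => x0; rewrite lt0_exponential_pdf ?mule0//.
    by rewrite ltNge; apply/negP.
  by rewrite integral_exponential_pdf ?invr_gt0// mule1 -EFinM divff.
- by move=> x; exact: laplace_pdf_ge0.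
- exact: continuous_laplace_pdf.
- by move=> x; rewrite /laplace_pdf /= normrN.
Qed.

(* By convention the Dirac mass at 0 for a nonpositive scale. *)
Definition laplace_prob s : set R -> \bar R := fun A =>
  if 0 < s then (\int[mu]_(x in A) (laplace_pdf s x)%:E)%E else \d_(0 : R) A.

Section laplace_prob.
Variable s : R.

Let laplace0 : laplace_prob s set0 = 0%E.
Proof. by rewrite /laplace_prob integral_set0 measure0 if_same. Qed.

Let laplace_ge0 A : (0 <= laplace_prob s A)%E.
Proof.
rewrite /laplace_prob; case: ifPn => // s0.
by apply: integral_ge0 => x _; rewrite lee_fin laplace_pdf_ge0.
Qed.

Let laplace_sigma_additive : semi_sigma_additive (laplace_prob s).
Proof.
move=> /= F mF tF mUF; rewrite /laplace_prob; case: ifPn => s0; last first.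
  exact: measure_semi_sigma_additive.
apply: cvg_toP.
  apply: ereal_nondecreasing_is_cvgn => m n mn.
  apply: lee_sum_nneg_natr => // k _ _; apply: integral_ge0 => /= x Fkx.
  by rewrite lee_fin laplace_pdf_ge0.
rewrite ge0_integral_bigcup//=.
- apply/measurable_funTS/measurableT_comp => //.
  exact: measurable_laplace_pdf.
- by move=> x _; rewrite lee_fin laplace_pdf_ge0.
Qed.

HB.instance Definition _ := isMeasure.Build _ _ _
  (laplace_prob s) laplace0 laplace_ge0 laplace_sigma_additive.

Let laplace_setT : laplace_prob s [set: R] = 1%E.
Proof.
rewrite /laplace_prob; case: ifPn => s0; first exact: integral_laplace_pdf.
exact: probability_setT.
Qed.

HB.instance Definition _ :=
  @Measure_isProbability.Build _ _ R (laplace_prob s) laplace_setT.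

End laplace_prob.
End laplace.

Section dwork_coins.
Context {R : realType}.

(* The discrete random choices on a stream of length T: the sampled set M, the
   initial bits, and one fresh bit per time step (ignored at the time steps t
   with s_t \notin M). *)
Definition dwork_coins (U : finType) (m T : nat) : Type :=
  ({set U} * m.-tuple bool * T.-tuple bool)%type.

HB.instance Definition _ U m T := Finite.on (dwork_coins U m T).
HB.instance Definition _ U m T := isPointed.Build (dwork_coins U m T)
  (finset.set0, nseq_tuple m false, nseq_tuple T false).
HB.instance Definition _ U m T :=
  @isMeasurable.Build default_measure_display (dwork_coins U m T)
    discrete_measurable discrete_measurable0
    discrete_measurableC discrete_measurableU.

Context {U : finType} {m T : nat}.
Variable eps : R.

Definition dwork_coins_pmf (w : dwork_coins U m T) : R :=
  (if #|w.1.1| == m then 'C(#|U|, m)%:R^-1 else 0)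
  * (\prod_(i < m) bernoulli_pmf (1 / 2) (tnth w.1.2 i))
  * (\prod_(t < T) bernoulli_pmf (1 / 2 + eps / 4) (tnth w.2 t)).

(* By convention the zero measure when the mass function takes a negative
   value, which does not happen for 0 < eps <= 1/2. *)
Definition dwork_coins_law : set (dwork_coins U m T) -> \bar R := fun A =>
  if [forall w, 0 <= dwork_coins_pmf w]
  then (\sum_(w | w \in A) (dwork_coins_pmf w)%:E)%E else 0%E.

Let law0 : dwork_coins_law set0 = 0%E.
Proof.
rewrite /dwork_coins_law; case: ifPn => // _.
by rewrite big_pred0// => x; rewrite in_set0.
Qed.

Let law_ge0 A : (0 <= dwork_coins_law A)%E.
Proof.
rewrite /dwork_coins_law; case: ifPn => // /forallP p0.
by apply: sume_ge0 => x _; rewrite lee_fin.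
Qed.

Let law_sigma_additive : semi_sigma_additive dwork_coins_law.
Proof.
move=> F mF tF mUF; rewrite /dwork_coins_law; case: ifPn => [/forallP p0|_].
  have pE (A : set (dwork_coins U m T)) :
      (\sum_(w | w \in A) (dwork_coins_pmf w)%:E =
       \sum_w mscale (NngNum (p0 w)) (\d_w) A)%E.
    rewrite big_mkcond/=; apply: eq_bigr => w _.
    by rewrite /mscale/= diracE; case: (w \in A); rewrite ?mule1 ?mule0.
  rewrite pE [X in X @ _ --> _](_ : _ = (fun n => \sum_w
      \sum_(0 <= i < n) mscale (NngNum (p0 w)) (\d_w) (F i))%E); last first.
    by apply/funext => n; rewrite exchange_big; apply: eq_bigr => i _; exact: pE.
  apply: cvg_nnesum => [w _|w _].
    by apply: nearW => n; exact: sume_ge0.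
  exact: (@measure_semi_sigma_additive _ _ _ (mscale (NngNum (p0 w)) (\d_w))).
by under eq_fun do rewrite big1//; exact: cvg_cst.
Qed.

HB.instance Definition _ := isMeasure.Build _ _ _
  dwork_coins_law law0 law_ge0 law_sigma_additive.

Let sum_bernoulli n (p : R) :
  \sum_(b : n.-tuple bool) \prod_(i < n) bernoulli_pmf p (tnth b i) = 1.
Proof.
have inj : bijective (fun f : {ffun 'I_n -> bool} => [tuple f i | i < n]).
  exists (fun b => [ffun i => tnth b i]) => [f|b].
    by apply/ffunP => i; rewrite ffunE tnth_mktuple.
  by apply: eq_from_tnth => i; rewrite tnth_mktuple ffunE.
rewrite (reindex _ (onW_bij _ inj))/=.
under eq_bigr do under eq_bigr do rewrite tnth_mktuple.
rewrite -(bigA_distr_bigA (fun _ b => bernoulli_pmf p b))/= big1// => i _.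
by rewrite big_bool/= addrC subrK.
Qed.

Lemma dwork_coins_lawT : 0 < eps <= 1 / 2 -> (m <= #|U|)%N ->
  dwork_coins_law [set: _] = 1%E.
Proof.
move=> /andP[e0 e1] mU; rewrite /dwork_coins_law ifT; last first.
  apply/forallP => w; rewrite /dwork_coins_pmf !mulr_ge0//.
  - by case: ifPn => // _; rewrite invr_ge0.
  - by apply: prodr_ge0 => i _; apply: bernoulli_pmf_ge0; lra.
  - by apply: prodr_ge0 => i _; apply: bernoulli_pmf_ge0; lra.
rewrite sumEFin; congr EFin.
under eq_bigl do rewrite in_setT.
rewrite /dwork_coins_pmf.
rewrite -(pair_bigA _ (fun (x : {set U} * m.-tuple bool) (y : T.-tuple bool) =>
  (if #|x.1| == m then 'C(#|U|, m)%:R^-1 else 0)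
  * (\prod_(i < m) bernoulli_pmf (1 / 2) (tnth x.2 i))
  * (\prod_(t < T) bernoulli_pmf (1 / 2 + eps / 4) (tnth y t))))/=.
under eq_bigr do rewrite -mulr_sumr sum_bernoulli mulr1.
rewrite -(pair_bigA _ (fun (x : {set U}) (y : m.-tuple bool) =>
  (if #|x| == m then 'C(#|U|, m)%:R^-1 else 0)
  * (\prod_(i < m) bernoulli_pmf (1 / 2) (tnth y i))))/=.
under eq_bigr do rewrite -mulr_sumr sum_bernoulli mulr1.
rewrite -big_mkcond/= sumr_const -card_draws -[LHS]mulr_natl.
have -> : #|[pred A : {set U} | #|A| == m]| = #|[set A : {set U} | #|A| == m]%SET|.
  by apply: eq_card => A; rewrite !inE.
by rewrite divff// pnatr_eq0 card_draws -lt0n bin_gt0.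
Qed.

End dwork_coins.
Arguments dwork_coins_law {R U m T} eps.

Section dwork.
Context {R : realType} {U : finType}.
Variables (eps : R) (m : nat) (S : seq U).

Definition density : R := #|[set u in S]%SET|%:R / #|U|%:R.

Definition dwork_step (M : seq U) (b : seq bool) (sc : U * bool) : seq bool :=
  if sc.1 \in M then set_nth false b (index sc.1 M) sc.2 else b.

(* The sampled set is ordered by the enumeration of U. *)
Definition dwork_bits (w : dwork_coins U m (size S)) : seq bool :=
  foldl (dwork_step (enum w.1.1)) w.1.2 (zip S w.2).

Definition dwork_estimate (w : dwork_coins U m (size S) * R) : R :=
  4 / eps * (1 / m%:R * (\sum_(b <- dwork_bits w.1) (b : nat)%:R) - 1 / 2) + w.2.

Definition dwork_prob :
    {measure set (dwork_coins U m (size S) * R) -> \bar R} :=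
  (dwork_coins_law eps \x laplace_prob (1 / (eps * m%:R)))%E.

Lemma dwork_prob_setT : 0 < eps <= 1 / 2 -> (m <= #|U|)%N ->
  dwork_prob [set: _] = 1%E.
Proof.
move=> eps01 mU; rewrite -setXTT /dwork_prob/= product_measure1E//=.
by rewrite dwork_coins_lawT// probability_setT mule1.
Qed.

End dwork.

(* Main.v *)
(* Given the sample M, the final bits are independent, with mean 1/2 + eps/4 for
   users of S and 1/2 for the others.  Hence the moment generating function of
   their sum is the average over M of prod_{u in M} x_u, a normalized elementary
   symmetric polynomial.  By a weak form of Maclaurin's inequality it is at most
   (mean of x)^m, the moment generating function of a sum of independent bits
   with mean 1/2 + eps/4 * d: sampling without replacement costs nothing.  A
   Chernoff bound at l = eps * alpha / 32 controls the bits up to alpha / 2, and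
   the tail of the Laplace noise beyond alpha / 2 obeys the same bound. *)
Require Import Defs.
From mathcomp Require Import all_boot all_order all_algebra.
From mathcomp Require Import all_classical all_reals all_analysis.
From mathcomp Require Import measurable_realfun ring lra.

Set Implicit Arguments.
Unset Strict Implicit.
Unset Printing Implicit Defensive.

Import Order.TTheory GRing.Theory Num.Theory.
Import numFieldNormedType.Exports.

Local Open Scope classical_set_scope.
Local Open Scope ring_scope.

(** Inverting [1 - x <= expR (- x)] gives [expR x <= 1 / (1 - x)]; multiplying the claim by [1 - x]
    then leaves [0 <= x ^+ 2 * (1 - 2 * x)]. *)
Lemma expR_le_quadratic (R : realType) (x : R) : x <= 1 / 2 ->
  expR x <= 1 + x + 2 * x ^+ 2.
Proof.
move=> x2; have := expR_ge1Dx (- x); rewrite expRN => h.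
have e0 : 0 < expR x by exact: expR_gt0.
have h' : (1 - x) * expR x <= 1.
  by rewrite -ler_pdivlMr// div1r.
have x1 : 0 < 1 - x by lra.
rewrite -(ler_pM2l x1); apply: (le_trans h').
suff : 0 <= x ^+ 2 * (1 - 2 * x) by lra.
by apply: mulr_ge0; [exact: sqr_ge0|lra].
Qed.

(** * Elementary symmetric polynomials and a weak Maclaurin inequality *)

Section symmetric_means.
Context {R : realFieldType} {U : finType}.
Implicit Types (x : U -> R) (k : nat).

(** Double counting: removing [v] from [A] is a bijection between sets with a marked element and
    sets with a marked non-element. *)
Lemma sum_setD1 (V : nmodType) k (F : {set U} -> U -> V) :
  \sum_(A : {set U} | #|A| == k.+1) \sum_(v in A) F (A :\ v)%SET v =
  \sum_(B : {set U} | #|B| == k) \sum_(v | v \notin B) F B v.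
Proof.
rewrite !pair_big_dep/=.
rewrite (reindex_onto (fun p : {set U} * U => (p.2 |: p.1, p.2)%SET)
  (fun p => (p.1 :\ p.2, p.2)%SET))/=; last first.
  by move=> [A v] /andP[_ vA]; rewrite /= finset.setD1K.
apply: eq_big => [[B v]|[B v]]/=.
  rewrite finset.setU11 andbT.
  have [vB|vB] := boolP (v \in B); rewrite ?andbF ?andbT.
    apply/negP => /andP[_ /eqP[e]]; move: vB.
    by rewrite -e !inE eqxx.
  by rewrite cardsU1 vB add1n eqSS finset.setU1K// eqxx andbT.
by move=> /andP[_ /eqP[->]].
Qed.

Lemma sum_mulrB_le0 (P : pred U) x :
  \sum_(v | P v) \sum_(u | P u) x v * (x u - x v) <= 0.
Proof.
set s := \sum_(_ | _) _.
have s2 : s + s = - \sum_(v | P v) \sum_(u | P u) (x u - x v) ^+ 2.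
  rewrite {2}/s exchange_big/= /s -big_split/= -sumrN; apply: eq_bigr => v _.
  by rewrite -big_split/= -sumrN; apply: eq_bigr => u _; ring.
suff : 0 <= \sum_(v | P v) \sum_(u | P u) (x u - x v) ^+ 2 by lra.
by apply: sumr_ge0 => v _; apply: sumr_ge0 => u _; exact: sqr_ge0.
Qed.

Definition elem_sym k x : R := \sum_(A : {set U} | #|A| == k) \prod_(u in A) x u.

(** Each set of size [k.+1] arises from a smaller one in [k.+1] ways, one for each element added
    last. *)
Lemma elem_symS k x : k.+1%:R * elem_sym k.+1 x =
  \sum_(A : {set U} | #|A| == k) (\prod_(u in A) x u) * \sum_(v | v \notin A) x v.
Proof.
under [RHS]eq_bigr do rewrite mulr_sumr.
rewrite -(sum_setD1 _ (fun A v => (\prod_(u in A) x u) * x v)) mulr_sumr.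
apply: eq_bigr => A /eqP cA; rewrite -cA mulr_natl -sumr_const.
by apply: eq_bigr => v vA; rewrite (big_setD1 v vA)/= mulrC.
Qed.

(* The difference of the two sides is a nonnegative combination of terms
   x_v (x_u - x_v), which symmetrize to - (x_u - x_v)^2 / 2. *)
Lemma elem_symS_le k x : (forall u, 0 <= x u) ->
  #|U|%:R * (k.+1%:R * elem_sym k.+1 x) <=
  (#|U| - k)%:R * (\sum_u x u) * elem_sym k x.
Proof.
move=> x0; rewrite elem_symS -subr_le0; set c := _ * \sum_u x u.
rewrite /elem_sym 2!mulr_sumr -sumrB.
set L := (X in X <= 0).
have -> : L = \sum_(A : {set U} | #|A| == k) (\prod_(u in A) x u) *
    \sum_(v in A) \sum_(u | u \notin A) (x u - x v).
  apply: eq_bigr => A /eqP cA.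
  have -> : \sum_(v in A) \sum_(u | u \notin A) (x u - x v) =
     #|U|%:R * (\sum_(u | u \notin A) x u) - (#|U| - k)%:R * \sum_u x u.
    under eq_bigr do rewrite sumrB sumr_const.
    rewrite sumrB sumr_const cA sumrMnl.
    have -> : #|[pred i | i \notin A]| = (#|U| - k)%N.
      by rewrite -(cardsC A) cA addKn; apply: eq_card => u; rewrite !inE.
    rewrite (bigID (mem A) predT)/= -[X in X - _]mulr_natl -[X in _ - X]mulr_natl.
    have kU : (k <= #|U|)%N by rewrite -cA max_card.
    by rewrite natrB//; ring.
  by rewrite /c; ring.
(* The empty set has no element to take out, so its inner sum is empty; all other sets are treated
   by removing some [v]. *)
case: k @c @L => [|k] /=.
  by apply: sumr_le0 => A /eqP/cards0_eq ->; rewrite big_set0 mul1r big_set0.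
under eq_bigr do rewrite mulr_sumr.
(* Removing [v] from [A] releases the factor [x v] and adds [u = v] to the inner sum, where the new
   term is zero. The range becomes symmetric in [u] and [v]. *)
have -> : \sum_(A : {set U} | #|A| == k.+1) \sum_(v in A) (\prod_(u in A) x u) *
      \sum_(u | u \notin A) (x u - x v) =
    \sum_(A : {set U} | #|A| == k) (\prod_(u in A) x u) *
      \sum_(v | v \notin A) \sum_(u | u \notin A) x v * (x u - x v).
  under [RHS]eq_bigr do rewrite mulr_sumr.
  rewrite -(sum_setD1 _ (fun A v => (\prod_(u in A) x u) *
      \sum_(u | u \notin A) x v * (x u - x v))).
  apply: eq_bigr => A _; apply: eq_bigr => v vA.
  rewrite (big_setD1 v vA)/= [X in _ = _ * X](bigD1 v)/=; last first.
    by rewrite !inE eqxx.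
  rewrite subrr mulr0 add0r -mulr_sumr mulrA (mulrC (x v)); congr (_ * _).
  apply: eq_bigl => u; rewrite !inE.
  by have [->|] := eqVneq u v; rewrite ?vA ?andbT.
apply: sumr_le0 => A _; apply: mulr_ge0_le0; last exact: sum_mulrB_le0.
by apply: prodr_ge0.
Qed.

Lemma elem_sym_le_mean k x : (0 < #|U|)%N -> (forall u, 0 <= x u) ->
  elem_sym k x <= 'C(#|U|, k)%:R * (#|U|%:R^-1 * \sum_u x u) ^+ k.
Proof.
move=> U0 x0; elim: k => [|k ih].
  rewrite bin0 expr0 mulr1 /elem_sym (big_pred1 finset.set0) ?big_set0//.
  by move=> A; rewrite /= cards_eq0.
have n0 : 0 < #|U|%:R :> R by rewrite ltr0n.
have c0 : 0 < #|U|%:R * k.+1%:R :> R by rewrite mulr_gt0 ?ltr0n.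
rewrite -(ler_pM2l c0) -mulrA; apply: le_trans (elem_symS_le k x0) _.
have s0 : 0 <= (#|U| - k)%:R * \sum_u x u.
  by rewrite mulr_ge0// sumr_ge0.
apply: le_trans (ler_wpM2l s0 ih) _.
(* The ratio of consecutive binomials is exactly the factor lost in [elem_symS_le]. *)
have bE : k.+1%:R * 'C(#|U|, k.+1)%:R = (#|U| - k)%:R * 'C(#|U|, k)%:R :> R.
  by rewrite -!natrM mul_bin_left.
set y := _ ^-1 * _.
have -> : \sum_u x u = #|U|%:R * y by rewrite /y mulVKf// lt0r_neq0.
rewrite [leRHS](_ : _ = #|U|%:R * (k.+1%:R * 'C(#|U|, k.+1)%:R) * y ^+ k.+1);
  last by ring.
by rewrite bE exprS le_eqVlt; apply/orP; left; apply/eqP; ring.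
Qed.

End symmetric_means.

(** * Joint law of the final bits, given the sample *)

Section bernoulli_mean.
Context {R : numDomainType}.
Implicit Types (p : R) (f : bool -> R).

Definition bernoulli_mean p f : R := p * f true + (1 - p) * f false.

Lemma sum_bernoulli_pmf p f :
  \sum_b bernoulli_pmf p b * f b = bernoulli_mean p f.
Proof. by rewrite big_bool. Qed.
End bernoulli_mean.

Lemma sum_tcons (V : nmodType) (T : finType) n (F : n.+1.-tuple T -> V) :
  \sum_c F c = \sum_x \sum_(c : n.-tuple T) F [tuple of x :: c].
Proof.
rewrite pair_bigA/=.
have bij : bijective (fun p : T * n.-tuple T => [tuple of p.1 :: p.2]).
  exists (fun c => (thead c, [tuple of behead c])) => [[x c]|c].
    by congr pair; apply: val_inj.
  by rewrite [RHS]tuple_eta.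
exact: reindex _ (onW_bij _ bij).
Qed.

Section refresh.
Context {R : numDomainType} {U : finType}.
Implicit Types (M S : seq U) (f : bool -> R) (g : U -> bool) (p q : R).

(** Keeps the bit array in the form [map g M], with only [g] changing, so that an induction on the
    stream can generalize over [g]. *)
Lemma dwork_step_map M g s y : uniq M ->
  dwork_step M (map g M) (s, y) = [seq if u == s then y else g u | u <- M].
Proof.
move=> uM; rewrite /dwork_step/=; case: ifPn => sM; last first.
  apply/eq_in_map => u uinM; case: eqP => // us.
  by move: sM; rewrite -us uinM.
have si : (index s M < size M)%N by rewrite index_mem.
apply: (@eq_from_nth _ false) => [|i].
  by rewrite size_set_nth !size_map; apply/maxn_idPr.
rewrite size_set_nth size_map (maxn_idPr si) => iM.
rewrite nth_set_nth/= !(nth_map s)// -(nth_uniq s iM si uM) nth_index//.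
Qed.

(* Induction on the first element of the stream: a bit refreshed at the first
   step matters only if its user does not occur again. *)
Lemma sum_refresh q f M g S : uniq M ->
  \sum_(c : (size S).-tuple bool)
    (\prod_t bernoulli_pmf q (tnth c t)) *
    \prod_(b <- foldl (dwork_step M) (map g M) (zip S c)) f b =
  \prod_(u <- M) (if u \in S then bernoulli_mean q f else f (g u)).
Proof.
move=> uM; elim: S g => [|s S ih] g.
  rewrite (big_pred1 [tuple]) => [|c]; last by apply/esym/eqP; exact: tuple0.
  by rewrite big_ord0 mul1r/= big_map.
rewrite sum_tcons.
transitivity (\sum_y bernoulli_pmf q y * \prod_(u <- M) (if u \in S
    then bernoulli_mean q f else f (if u == s then y else g u))).
  apply: eq_bigr => y _; rewrite -ih mulr_sumr; apply: eq_bigr => c _.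
  rewrite big_ord_recl tnth0 -mulrA; congr (_ * (_ * _)).
    by apply: eq_bigr => i _; rewrite tnthS.
  by rewrite /= dwork_step_map.
have [/andP[sM sS]|ns] := boolP ((s \in M) && (s \notin S)).
  rewrite [RHS](bigD1_seq s)//= in_cons eqxx/= -sum_bernoulli_pmf mulr_suml.
  apply: eq_bigr => y _.
  rewrite (bigD1_seq s)//= (negbTE sS) eqxx mulrA; congr (_ * _).
  by apply: eq_bigr => u us; rewrite in_cons (negbTE us).
(* Here [s] is not sampled or occurs again, so no factor depends on [y], whose probabilities add up
   to 1. *)
transitivity (\sum_y bernoulli_pmf q y *
    \prod_(u <- M) (if u \in s :: S then bernoulli_mean q f else f (g u))).
  apply: eq_bigr => y _; congr (_ * _); apply: eq_big_seq => u uinM.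
  rewrite in_cons; have [us|//] := eqVneq u s.
  by move: ns; rewrite -us uinM/= negbK => ->.
by rewrite -mulr_suml big_bool/= addrC subrK mul1r.
Qed.

(** After [sum_refresh], each factor depends on one initial bit only, so the sum over initial bits
    distributes over the product. *)
Lemma sum_init_refresh p q f M m S : uniq M -> size M = m ->
  \sum_(b : m.-tuple bool) (\prod_i bernoulli_pmf p (tnth b i)) *
    \sum_(c : (size S).-tuple bool) (\prod_t bernoulli_pmf q (tnth c t)) *
      \prod_(y <- foldl (dwork_step M) b (zip S c)) f y =
  \prod_(u <- M) bernoulli_mean (if u \in S then q else p) f.
Proof.
move=> uM sM; move/eqP: (sM) => sM'; pose t : m.-tuple U := Tuple sM'.
(* Views an arbitrary initial array as [map g M]; the default [false] is never read for users of
   [M]. *)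
have bE (b : m.-tuple bool) : tval b = [seq nth false b (index u M) | u <- M].
  apply: (@eq_from_nth _ false) => [|i]; first by rewrite size_map size_tuple sM.
  rewrite size_tuple => im; have iM : (i < size M)%N by rewrite sM.
  by rewrite (nth_map (tnth t (Ordinal im)))// index_uniq.
have big_M (h : U -> R) : \prod_(u <- M) h u = \prod_i h (tnth t i).
  exact: big_tuple _ _ t predT h.
pose F i b := bernoulli_pmf p b *
  (if tnth t i \in S then bernoulli_mean q f else f b).
transitivity (\sum_(b : m.-tuple bool) \prod_i F i (tnth b i)).
  apply: eq_bigr => b _.
  rewrite bE sum_refresh// big_M.
  rewrite -big_split/=; apply: eq_bigr => i _; rewrite /F (tnth_nth (tnth t i)).
  by rewrite index_uniq ?sM// !(tnth_nth false b).
have inj : bijective (fun h : {ffun 'I_m -> bool} => [tuple h i | i < m]).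
  exists (fun b => [ffun i => tnth b i]) => [h|b].
    by apply/ffunP => i; rewrite ffunE tnth_mktuple.
  by apply: eq_from_tnth => i; rewrite tnth_mktuple ffunE.
rewrite (reindex _ (onW_bij _ inj))/=.
under eq_bigr do under eq_bigr do rewrite tnth_mktuple.
rewrite -(bigA_distr_bigA F) big_M.
apply: eq_bigr => i _; rewrite /F.
case: ifP => _; last by rewrite sum_bernoulli_pmf.
by rewrite -mulr_suml big_bool/= addrC subrK mul1r.
Qed.
End refresh.

(** * Tail of the Laplace noise *)

Lemma measurable_norm_ge (R : realType) (c : R) :
  measurable [set x : R | c <= `|x|].
Proof.
rewrite -[X in measurable X]setTI.
have /(_ measurableT _ (measurable_itv `[c, +oo[)) := @normr_measurable R setT.
rewrite (_ : _ @^-1` _ = [set x : R | c <= `|x|]); first exact.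
by apply/seteqP; split => x; rewrite /= in_itv/= andbT.
Qed.

(* On the tail, the density at scale s is at most 2 exp(-c/2s) times the
   density at scale 2s, which integrates to 1. *)
Lemma laplace_tail (R : realType) (s c : R) : 0 < s ->
  (laplace_prob s [set x | (c <= `|x|)%R] <= (2 * expR (- c / (2 * s)))%:E)%E.
Proof.
move=> s0; set A := [set x | _]; have mA : measurable A by exact: measurable_norm_ge.
have s20 : 0 < 2 * s by rewrite mulr_gt0.
set K := 2 * _; have K0 : 0 <= K by rewrite mulr_ge0// expR_ge0.
have mpdf t D : measurable_fun D (fun x => (laplace_pdf t x)%:E : \bar R).
  by apply/measurable_funTS/measurable_EFinP; exact: measurable_laplace_pdf.
have ge0 t x : 0 < t -> (0 <= (laplace_pdf t x)%:E :> \bar R)%E.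
  by move=> t0; rewrite lee_fin laplace_pdf_ge0.
rewrite /laplace_prob s0.
apply: (@le_trans _ _
    (\int[lebesgue_measure]_(x in A) (K%:E * (laplace_pdf (2 * s) x)%:E))%E).
  apply: ge0_le_integral => //=.
  - by move=> x _; exact: ge0.
  - exact: mpdf.
  - by apply: measurable_funeM; exact: mpdf.
  move=> x; rewrite /A/= => cx; rewrite -EFinM lee_fin /laplace_pdf /K.
  have -> : - `|x| / s = - `|x| / (2 * s) + - `|x| / (2 * s).
    by field; rewrite lt0r_neq0.
  rewrite expRD.
  have -> : 2 * expR (- c / (2 * s)) * ((2 * (2 * s))^-1 * expR (- `|x| / (2 * s))) =
     (2 * s)^-1 * (expR (- c / (2 * s)) * expR (- `|x| / (2 * s))).
    by field; rewrite lt0r_neq0.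
  rewrite ler_pM2l ?invr_gt0// ler_pM2r ?expR_gt0// ler_expR.
  by rewrite ler_pM2r ?invr_gt0// lerN2.
rewrite ge0_integralZl//=; [|exact: mpdf|by move=> x _; exact: ge0].
rewrite -[leRHS]mule1 lee_wpmul2l//.
rewrite -(integral_laplace_pdf s20); apply: ge0_subset_integral => //=; first exact: mpdf.
by move=> x _; exact: ge0.
Qed.

(** * The sample size and its growth *)

Section sample_size.
Context {R : realType}.

(** Solves [4 * expR (- (m * eps ^+ 2 * alpha ^+ 2 / 512)) <= beta] for [m]: the 4 counts 2 for the
    bits and 2 for the noise. The successor rounds up and makes the size positive. *)
Definition dwork_sample_size (eps alpha beta : R) : nat :=
  (Num.truncn (512 / (eps ^+ 2 * alpha ^+ 2) * ln (4 / beta))).+1.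

Lemma dwork_sample_size_ge (eps alpha beta : R) :
  0 < eps -> 0 < alpha -> 0 < beta ->
  4 * expR (- ((dwork_sample_size eps alpha beta)%:R * (eps ^+ 2 * alpha ^+ 2) / 512))
    <= beta.
Proof.
move=> e0 a0 b0; have q0 : 0 < eps ^+ 2 * alpha ^+ 2 by rewrite mulr_gt0 ?exprn_gt0.
have := ltW (truncnS_gt (512 / (eps ^+ 2 * alpha ^+ 2) * ln (4 / beta))).
rewrite -/(dwork_sample_size _ _ _); set m := _%:R.
rewrite mulrAC ler_pdivrMr// => h.
rewrite -ler_pdivlMl// -[leRHS]lnK ?posrE ?mulr_gt0 ?invr_gt0//.
rewrite ler_expR -[4^-1 * beta]invrK invfM invrK lnV; last first.
  by rewrite posrE mulr_gt0// invr_gt0.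
by rewrite lerN2 ler_pdivlMr// mulrC.
Qed.

Lemma dwork_sample_size_bigO :
  (fun p : R * R * R => (dwork_sample_size p.1.1 p.1.2 p.2)%:R : R)
      =O_ (filter_prod (filter_prod (0 : R)^'+ (0 : R)^'+) (0 : R)^'+)
      (fun p : R * R * R =>
         1 / (p.1.1 ^+ 2 * p.1.2 ^+ 2) * ln (1 / p.2) : R).
Proof.
apply/eqOP; near=> k.
(* 1025 is 512 times 2, from [ln (4 / b) <= 2 * ln (1 / b)], plus 1 for the rounding. *)
have k0 : 1025 <= k by near: k; exact: nbhs_pinfty_ge (num_real _).
(* [b < 1 / 4] gives the comparison of logarithms; [b < expR (-1)] and [e, a < 1] make the bounding
   function at least 1, so that it absorbs the rounding. *)
exists ([set p : R * R | [/\ 0 < p.1, p.1 < 1, 0 < p.2 & p.2 < 1]],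
  [set b : R | [/\ 0 < b, b < 1 / 4 & b < expR (-1)]]) => /=.
  split.
    exists ([set x : R | 0 < x < 1], [set x : R | 0 < x < 1]) => /=.
      have n01 : \forall x \near (0 : R)^'+, 0 < x < 1.
        by near=> x; apply/andP; split; near: x;
          [exact: nbhs_right_gt|exact: nbhs_right_lt].
      by split.
    by move=> [e a] [/andP[? ?] /andP[? ?]].
  near=> b; split => //; near: b; exact: nbhs_right_lt.
move=> [[e a] b] [[/= e0 e1 a0 a1] [b0 b4 be]].
have q0 : 0 < e ^+ 2 * a ^+ 2 by rewrite mulr_gt0 ?exprn_gt0.
have q1 : e ^+ 2 * a ^+ 2 <= 1 by rewrite mulr_ile1 ?exprn_ile1// ltW// exprn_gt0.
have L1 : 1 <= ln (1 / b).
  rewrite -[leLHS]expRK ler_ln ?posrE ?expR_gt0 ?divr_gt0// div1r.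
  by rewrite -[leLHS]invrK lef_pV2 ?posrE ?invr_gt0 ?expR_gt0// -expRN ltW.
have L2 : ln (4 / b) <= 2 * ln (1 / b).
  have -> : 2 * ln (1 / b) = ln (1 / b) + ln (1 / b) by ring.
  rewrite -lnM ?posrE ?divr_gt0//.
  rewrite ler_ln ?posrE ?divr_gt0 ?mulr_gt0 ?divr_gt0 ?invr_gt0//.
  by rewrite !mul1r ler_pM2r ?invr_gt0// -div1r ler_pdivlMr//; lra.
have L40 : 0 <= ln (4 / b) by apply: ln_ge0; rewrite ler_pdivlMr//; lra.
set Q := e ^+ 2 * a ^+ 2 in q0 q1 *; set L := ln (1 / b) in L1 L2 *.
have iq1 : 1 <= 1 / Q by rewrite ler_pdivlMr ?mul1r.
have iq0 : 0 <= 1 / Q by exact: le_trans iq1.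
have iqL : 1 <= 1 / Q * L by exact: mulr_ege1.
have iqL2 : 1 / Q * ln (4 / b) <= 1 / Q * (2 * L) by exact: ler_wpM2l.
have T0 : 0 <= 512 / Q * ln (4 / b).
  by apply: mulr_ge0 L40; apply: divr_ge0; [exact: ler0n|exact: ltW].
have mle : (dwork_sample_size e a b)%:R <= 512 / Q * ln (4 / b) + 1.
  by rewrite /dwork_sample_size -natr1 lerD2r truncn_le.
rewrite normr_nat ger0_norm; last by exact: le_trans iqL.
apply: le_trans mle _.
apply: (@le_trans _ _ (1025 * (1 / Q * L))); last first.
  by apply: ler_wpM2r k0; exact: le_trans iqL.
clear -iqL iqL2; lra.
Unshelve. all: by end_near.
Qed.
End sample_size.

(** * Concentration of the bits and of the noisy estimate *)

Section dwork_concentration.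
Context {R : realType} {U : finType}.
Variables (eps : R) (m : nat) (S : seq U).
Hypotheses (eps01 : 0 < eps <= 1 / 2) (mU : (m <= #|U|)%N).

Definition bit_sum (w : dwork_coins U m (size S)) : R :=
  \sum_(b <- dwork_bits w) (b : nat)%:R.

(** The mean of the final bit of a uniformly random user. *)
Definition bit_mean : R := 1 / 2 + eps / 4 * density S.

Lemma density_itv : 0 <= (density S : R) <= 1.
Proof.
rewrite /density divr_ge0//=.
(* For empty [U] the density is 0, as the inverse of 0 is 0. *)
have [->|] := posnP #|U|; first by rewrite invr0 mulr0.
by move=> U0; rewrite ler_pdivrMr ?ltr0n// mul1r ler_nat max_card.
Qed.

Lemma dwork_coins_pmf_ge0 w : 0 <= dwork_coins_pmf (m := m) (U := U) (T := size S) eps w.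
Proof.
move/andP: eps01 => [e0 e1]; rewrite /dwork_coins_pmf !mulr_ge0//.
- by case: ifPn => // _; rewrite invr_ge0.
- by apply: prodr_ge0 => i _; apply: bernoulli_pmf_ge0; lra.
- by apply: prodr_ge0 => i _; apply: bernoulli_pmf_ge0; lra.
Qed.

Definition bit_mgf (l : R) (u : U) : R :=
  bernoulli_mean (if u \in S then 1 / 2 + eps / 4 else 1 / 2)
    (fun b => expR (l * (b : nat)%:R)).

(** Summing out the coins leaves a product over the sampled users, in which their order is lost; the
    uniform choice of the sample averages it over all sets of size [m]. *)
Lemma bit_sum_mgf l : \sum_w dwork_coins_pmf eps w * expR (l * bit_sum w) =
  'C(#|U|, m)%:R^-1 * elem_sym m (bit_mgf l).
Proof.
under eq_bigr do rewrite /bit_sum mulr_sumr expR_sum.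
rewrite -(pair_bigA _ (fun (p : {set U} * m.-tuple bool) (c : (size S).-tuple bool) =>
  dwork_coins_pmf eps (p, c) * \prod_(b <- dwork_bits (p, c)) expR (l * (b : nat)%:R)))/=.
rewrite -(pair_bigA _ (fun (M : {set U}) (b0 : m.-tuple bool) =>
  \sum_(c : (size S).-tuple bool) dwork_coins_pmf eps (M, b0, c) *
  \prod_(b <- dwork_bits (M, b0, c)) expR (l * (b : nat)%:R)))/=.
rewrite /elem_sym mulr_sumr [RHS]big_mkcond/=; apply: eq_bigr => M _.
rewrite /dwork_coins_pmf/=; case: ifPn => [/eqP cM|_]; last first.
  by rewrite big1// => b _; rewrite big1// => c _; rewrite !mul0r.
have sM : size (enum M) = m by rewrite -cM cardE.
have := sum_init_refresh (1 / 2) (1 / 2 + eps / 4)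
  (fun b => expR (l * (b : nat)%:R)) S (enum_uniq (mem M)) sM.
rewrite [X in _ = X -> _]big_enum /= /bit_mgf => <-.
rewrite mulr_sumr; apply: eq_bigr => b _.
by rewrite mulrA mulr_sumr; apply: eq_bigr => c _; rewrite -!mulrA.
Qed.

(** Negative [l] is allowed, so the bound serves both tails. *)
Lemma bit_sum_mgf_le l : (0 < m)%N -> l <= 1 / 2 ->
  \sum_w dwork_coins_pmf eps w * expR (l * (bit_sum w - m%:R * bit_mean))
  <= expR (m%:R * (2 * l ^+ 2)).
Proof.
move=> m0 l2; move/andP: eps01 => [e0 e1].
have U0 : (0 < #|U|)%N by exact: leq_trans mU.
have U0' : #|U|%:R != 0 :> R by rewrite pnatr_eq0 -lt0n.
have [d0 d1] := andP density_itv.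
have x0 u : 0 <= bit_mgf l u.
  by rewrite /bit_mgf/bernoulli_mean; case: ifP => _;
    rewrite addr_ge0// mulr_ge0 ?expR_ge0//; lra.
have xE : #|U|%:R^-1 * \sum_u bit_mgf l u = 1 + bit_mean * (expR l - 1).
  have -> : \sum_u bit_mgf l u = \sum_u ((1 / 2 * (expR l + 1)) +
     eps / 4 * (expR l - 1) * (u \in S)%:R).
    apply: eq_bigr => u _; rewrite /bit_mgf /bernoulli_mean/= mulr1 mulr0 expR0.
    by case: (u \in S) => /=; field.
  rewrite big_split/= sumr_const -mulr_sumr -natr_sum.
  have -> : (\sum_u (u \in S : nat))%N = #|[set u in S]%SET|.
    by rewrite -sum1_card [RHS]big_mkcond/=; apply: eq_bigr => u _; rewrite inE; case: ifP.
  by rewrite cardT -cardE -mulr_natl /bit_mean /density; field.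
have xle : #|U|%:R^-1 * \sum_u bit_mgf l u <= expR (bit_mean * l + 2 * l ^+ 2).
  rewrite xE; apply: le_trans (expR_ge1Dx _).
  rewrite lerD2l.
  have p0 : 0 <= bit_mean by rewrite /bit_mean addr_ge0// mulr_ge0//; lra.
  have p1 : bit_mean <= 1.
    suff : eps / 4 * density S <= 1 / 8 * 1 by rewrite /bit_mean; lra.
    by apply: ler_pM => //; lra.
  (* The linear term must keep [bit_mean] to cancel against the centering; in the quadratic one it
     is bounded by 1. *)
  apply: (@le_trans _ _ (bit_mean * (l + 2 * l ^+ 2))).
    by rewrite ler_wpM2l//; have := expR_le_quadratic l2; lra.
  rewrite mulrDr lerD2l ler_piMl// mulr_ge0//; exact: sqr_ge0.
have -> : \sum_w dwork_coins_pmf eps w * expR (l * (bit_sum w - m%:R * bit_mean)) =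
    (\sum_w dwork_coins_pmf eps w * expR (l * bit_sum w)) * expR (- (l * (m%:R * bit_mean))).
  by rewrite mulr_suml; apply: eq_bigr => w _; rewrite mulrBr expRD mulrA.
rewrite bit_sum_mgf.
have C0 : 0 < 'C(#|U|, m)%:R :> R by rewrite ltr0n bin_gt0.
have : 'C(#|U|, m)%:R^-1 * elem_sym m (bit_mgf l) <= expR (bit_mean * l + 2 * l ^+ 2) ^+ m.
  rewrite ler_pdivrMl//; apply: le_trans (elem_sym_le_mean m U0 x0) _.
  apply: ler_wpM2l; first exact: ltW.
  apply: lerXn2r => //; rewrite nnegrE ?expR_ge0//.
  by rewrite mulr_ge0// sumr_ge0.
move=> h; apply: le_trans (ler_wpM2r (expR_ge0 _) h) _.
rewrite -expRM_natl -expRD ler_expR; lra.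
Qed.

Local Notation coins_law := (@dwork_coins_law R U m (size S) eps).

(** Markov's inequality: [f] dominates the indicator of [A]. *)
Lemma dwork_coins_law_le (A : set (dwork_coins U m (size S)))
    (f : dwork_coins U m (size S) -> R) :
  (forall w, 0 <= f w) -> (forall w, A w -> 1 <= f w) ->
  (coins_law A <= (\sum_w dwork_coins_pmf eps w * f w)%:E)%E.
Proof.
move=> f0 f1; rewrite /dwork_coins_law ifT; last first.
  by apply/forallP; exact: dwork_coins_pmf_ge0.
rewrite sumEFin lee_fin big_mkcond/=; apply: ler_sum => w _.
case: ifPn => [|_]; last by rewrite mulr_ge0// dwork_coins_pmf_ge0.
by rewrite inE => /f1 h; rewrite ler_peMr// dwork_coins_pmf_ge0.
Qed.

Definition noiseless_estimate (w : dwork_coins U m (size S)) : R :=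
  4 / eps * (1 / m%:R * bit_sum w - 1 / 2).

Lemma noiseless_tail (alpha : R) : (0 < m)%N -> 0 < alpha < 1 ->
  (coins_law [set w | (alpha / 2 <= `|noiseless_estimate w - density S|)%R]
   <= (2 * expR (- (m%:R * (eps ^+ 2 * alpha ^+ 2) / 512)))%:E)%E.
Proof.
move=> m0 /andP[a0 a1]; move/andP: eps01 => [e0 e1].
have m0' : 0 < m%:R :> R by rewrite ltr0n.
(* An error [alpha / 2] of the estimate is an error [d] of the bit average, by the scaling
   [4 / eps]. The choice of [l] minimizes [2 * l ^+ 2 - l * d], with value [- d ^+ 2 / 8], whence
   the 512. *)
pose d := eps * alpha / 8; pose l := d / 4.
have d0 : 0 < d by rewrite /d divr_gt0// mulr_gt0.
have d1 : d <= 1.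
  have : eps * alpha <= 1 * 1 by apply: ler_pM; lra.
  by rewrite /d; lra.
pose g w := bit_sum w - m%:R * bit_mean.
(* One exponential for each sign of the deviation, hence the factor 2 in the bound. *)
pose f w := (expR (l * g w) + expR (- l * g w)) * expR (- (l * (m%:R * d))).
have f0 w : 0 <= f w by rewrite mulr_ge0 ?addr_ge0 ?expR_ge0.
apply: le_trans (dwork_coins_law_le f0 _) _.
  move=> w /= h.
  have gE : g w = m%:R * eps / 4 * (noiseless_estimate w - density S).
    rewrite /g /noiseless_estimate /bit_mean; field.
    by rewrite !lt0r_neq0.
  have {}h : m%:R * d <= `|g w|.
    rewrite gE normrM gtr0_norm ?divr_gt0 ?mulr_gt0// /d.
    have -> : m%:R * (eps * alpha / 8) = m%:R * eps / 4 * (alpha / 2) by field.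
    by rewrite ler_pM2l// divr_gt0 ?mulr_gt0.
  rewrite /f -[leLHS](expR0) -[X in expR X](subrr (l * (m%:R * d))) expRD.
  rewrite ler_wpM2r ?expR_ge0//.
  have l0 : 0 < l by rewrite /l divr_gt0.
  move: h; rewrite ler_normr => /orP[h|h].
    rewrite -[leLHS]addr0 lerD ?expR_ge0// ler_expR ler_pM2l//.
  by rewrite -[leLHS]add0r lerD ?expR_ge0// ler_expR mulNr -mulrN ler_pM2l.
rewrite lee_fin /f.
have -> : \sum_w dwork_coins_pmf eps w *
    ((expR (l * g w) + expR (- l * g w)) * expR (- (l * (m%:R * d)))) =
  (\sum_w dwork_coins_pmf eps w * expR (l * g w) +
   \sum_w dwork_coins_pmf eps w * expR (- l * g w)) * expR (- (l * (m%:R * d))).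
  rewrite -big_split/= mulr_suml; apply: eq_bigr => w _.
  by rewrite -mulrDr mulrA.
have h1 : l <= 1 / 2 by rewrite /l; lra.
have h2 : - l <= 1 / 2 by rewrite /l; lra.
have k1 := bit_sum_mgf_le m0 h1; have k2 := bit_sum_mgf_le m0 h2.
rewrite sqrrN in k2.
apply: le_trans (ler_wpM2r (expR_ge0 _) (lerD k1 k2)) _.
rewrite [leLHS](_ : _ = 2 * (expR (m%:R * (2 * l ^+ 2)) *
  expR (- (l * (m%:R * d))))); last by ring.
rewrite -expRD ler_pM2l// ler_expR.
by rewrite /l /d le_eqVlt; apply/orP; left; apply/eqP; field.
Qed.

Lemma dwork_estimate_tail (alpha : R) : (0 < m)%N -> 0 < alpha < 1 ->
  (dwork_prob eps m S [set w | (alpha <= `|dwork_estimate eps w - density S|)%R]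
   <= (4 * expR (- (m%:R * (eps ^+ 2 * alpha ^+ 2) / 512)))%:E)%E.
Proof.
move=> m0 a01; have [a0 a1] := andP a01; have [e0 e1] := andP eps01.
have m0' : 0 < m%:R :> R by rewrite ltr0n.
set E := [set w | _].
pose A := [set w | (alpha / 2 <= `|noiseless_estimate w - density S|)%R].
pose B := [set y : R | alpha / 2 <= `|y|].
(* The coins carry the discrete sigma-algebra. *)
have mA : measurable A by [].
have mB : measurable B by exact: measurable_norm_ge.
have mnl : measurable_fun setT noiseless_estimate by [].
have mE : measurable E.
  have mf : measurable_fun setT
     (fun w : dwork_coins U m (size S) * R => dwork_estimate eps w - density S).
    apply: measurable_funB => //; apply: measurable_funD => //.
    exact: (measurableT_comp mnl measurable_fst).
  have := mf measurableT _ (measurable_norm_ge alpha).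
  (* The preimage of the tail set under the error is [E] itself. *)
  by rewrite setTI.
(* Union bound: an error of [alpha] needs [alpha / 2] from the bits or from the noise. *)
have EAB : E `<=` (A `*` setT) `|` (setT `*` B).
  move=> [w y]; rewrite /E/A/B/= => h.
  have [hA|hA] := leP (alpha / 2) `|noiseless_estimate w - density S|; first by left.
  right; split => //; move: h; rewrite /dwork_estimate/= -/(bit_sum w) -/(noiseless_estimate w).
  rewrite addrAC => h; have := ler_normD (noiseless_estimate w - density S) y; lra.
have mAT : measurable (A `*` (setT : set R)) by exact: measurableX.
have mTB : measurable ((setT : set (dwork_coins U m (size S))) `*` B) by exact: measurableX.
apply: (@le_trans _ _ (dwork_prob eps m S (A `*` setT) + dwork_prob eps m S (setT `*` B))%E).
  apply: le_trans (measureU2 _ mAT mTB).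
  by apply: le_measure; rewrite ?inE//; exact: measurableU.
have -> : dwork_prob eps m S (A `*` setT) = coins_law A.
  by rewrite /dwork_prob/= product_measure1E//= probability_setT mule1.
have -> : dwork_prob eps m S (setT `*` B) = laplace_prob (1 / (eps * m%:R)) B.
  by rewrite /dwork_prob/= product_measure1E//= dwork_coins_lawT// mul1e.
have -> : 4 * expR (- (m%:R * (eps ^+ 2 * alpha ^+ 2) / 512)) =
  2 * expR (- (m%:R * (eps ^+ 2 * alpha ^+ 2) / 512)) +
  2 * expR (- (m%:R * (eps ^+ 2 * alpha ^+ 2) / 512)) by lra.
rewrite EFinD; apply: leeD; first exact: noiseless_tail.
have s0 : 0 < 1 / (eps * m%:R) by rewrite divr_gt0// mulr_gt0.
apply: le_trans (laplace_tail _ s0) _.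
rewrite lee_fin ler_pM2l// ler_expR.
have -> : - (alpha / 2) / (2 * (1 / (eps * m%:R))) = - (m%:R * (eps * alpha) / 4).
  by field; rewrite !lt0r_neq0.
rewrite lerN2 -!mulrA ler_pM2l//.
(* The noise exponent is linear in [eps * alpha <= 1], hence it beats the quadratic one of the
   bits. *)
have : (eps * alpha) * (eps * alpha) <= 1 * (eps * alpha).
  rewrite ler_pM2r ?mulr_gt0//.
  by rewrite -[leRHS]mulr1; apply: ler_pM; lra.
have : 0 < eps * alpha by rewrite mulr_gt0.
lra.
Qed.

End dwork_concentration.

Theorem theorem4p3 (R : realType) :
  exists m : R -> R -> R -> nat,
    (fun p : R * R * R => (m p.1.1 p.1.2 p.2)%:R : R)
      =O_ (filter_prod (filter_prod (0 : R)^'+ (0 : R)^'+) (0 : R)^'+)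
      (fun p : R * R * R =>
         1 / (p.1.1 ^+ 2 * p.1.2 ^+ 2) * ln (1 / p.2) : R)
    /\
    forall eps alpha beta : R,
      0 < eps <= 1 / 2 -> 0 < alpha < 1 -> 0 < beta < 1 ->
      (0 < m eps alpha beta)%N /\
      forall (U : finType) (S : seq U), (m eps alpha beta <= #|U|)%N ->
        (dwork_prob eps (m eps alpha beta) S
           [set w | (alpha <= `|dwork_estimate eps w - density S|)%R]
         <= beta%:E)%E.
Proof.
exists dwork_sample_size; split; first exact: dwork_sample_size_bigO.
move=> eps alpha beta e01 a01 /andP[b0 b1]; split => // U S mU.
apply: le_trans (dwork_estimate_tail S e01 mU _ a01) _ => //.
rewrite lee_fin; move: e01 a01 => /andP[e0 _] /andP[a0 _].
exact: dwork_sample_size_ge.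
Qed.
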